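(* Let $a,b,c,\alpha\in\mathbb{R}$ with $c>0$, $0<\alpha\le 1/2$ and $a<-|b|$. Then the equation $D^{\alpha}x(t)+c\,D^{2\alpha}x(t)=a\,x(t)+b\,x(t-\tau)$ has no critical value of delay $\tau_*$, and the stability of this equation is independent of the delay $\tau$.
   Context: $D^{\mu}$ denotes the Caputo fractional derivative (base point $0$) in $t$: for $m\in\mathbb{N}$ and $m-1<\mu<m$, $D^{\mu}f(t)=\frac{1}{\Gamma(m-\mu)}\int_0^t (t-s)^{m-\mu-1}f^{(m)}(s)\,ds$, and $D^{m}f=f^{(m)}$. The equation is considered for $t>0$ with delay $\tau\ge 0$ and a prescribed history on $[-\tau,0]$. Characteristic equation: $\lambda^{\alpha}+c\lambda^{2\alpha}=a+b\,e^{-\lambda\tau}$ (principal branch of powers). Critical value of delay: a number $\tau_*\ge 0$ for which the characteristic equation with $\tau=\tau_*$ has a root $\lambda=iv$ with $v>0$; equivalently, there is $v>0$ such that $$v^{\alpha}\cos\left(\tfrac{\alpha\pi}{2}\right)+c\,v^{2\alpha}\cos(\alpha\pi)-a=b\cos(v\tau_* ),\qquad v^{\alpha}\sin\left(\tfrac{\alpha\pi}{2}\right)+c\,v^{2\alpha}\sin(\alpha\pi)=-b\sin(v\tau_* ).$$ Stability: for a given $\tau\ge0$ the equation is called stable if all its solutions are bounded as $t\to\infty$, and unstable if it is not stable. ''The stability is independent of the delay $\tau$'' means: if the equation with $\tau=0$, i.e. $D^{\alpha}x(t)+c\,D^{2\alpha}x(t)=(a+b)x(t)$, is stable (respectively,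 unstable), then the delayed equation is stable (respectively, unstable) for all $\tau\ge 0$. *)

(* Defs.v *)
From HB Require Import structures.
From mathcomp Require Import all_boot all_order all_algebra.
From mathcomp Require Import all_classical all_reals all_analysis.
From mathcomp Require Import complex.

Set Implicit Arguments.
Unset Strict Implicit.
Unset Printing Implicit Defensive.

Import Order.TTheory GRing.Theory Num.Theory.
Import numFieldNormedType.Exports.

Local Open Scope classical_set_scope.
Local Open Scope ring_scope.

Definition Gamma {R : realType} (z : R) : R :=
  \int[lebesgue_measure]_(u in `]0, +oo[) (u `^ (z - 1) * expR (- u)).

(* For mu > 0 this is the m with m - 1 < mu <= m. *)
Definition caputo_order {R : realType} (mu : R) : nat := `|Num.ceil mu|%N.

Definition caputo_integrand {R : realType} (mu : R) (f : R -> R) (t s : R) : R :=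
  (t - s) `^ ((caputo_order mu)%:R - mu - 1) * derive1n (caputo_order mu) f s.

(* Caputo derivative with base point 0, for mu > 0 and t > 0. *)
Definition caputo {R : realType} (mu : R) (f : R -> R) (t : R) : R :=
  let m := caputo_order mu in
  if mu == m%:R then derive1n m f t
  else (Gamma (m%:R - mu))^-1 *
       \int[lebesgue_measure]_(s in `]0, t[) caputo_integrand mu f t s.

(* The operations above are total, so the existence of the derivative has to be
   required separately.  For integer mu = m the function must be m times
   differentiable at every t > 0.  For m - 1 < mu < m, f^(m-1) is only required
   to be locally absolutely continuous, expressed as: it is differentiable
   almost everywhere and is the Lebesgue integral of its derivative.
   Differentiability everywhere would be too strong: at the points t = k tau
   a solution of a fractional delay equation may fail to be differentiable. *)
Definition caputo_differentiable {R : realType} (mu : R) (f : R -> R) : Prop :=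
  let m := caputo_order mu in
  if mu == m%:R then
    forall (k : nat) (t : R), (k < m)%N -> 0 < t -> derivable (derive1n k f) t 1
  else
    [/\ forall (k : nat) (t : R), (k < m.-1)%N -> 0 < t ->
          derivable (derive1n k f) t 1,
        {ae @lebesgue_measure R,
          forall s, 0 < s -> derivable (derive1n m.-1 f) s 1},
        forall t : R, 0 < t ->
          lebesgue_measure.-integrable `]0, t[ (EFin \o caputo_integrand mu f t)
      & forall s t : R, 0 < s -> s < t ->
          derive1n m.-1 f t - derive1n m.-1 f s =
          \int[lebesgue_measure]_(r in `]s, t[) derive1n m f r].

(* Solutions of D^alpha x(t) + c D^(2 alpha) x(t) = a x(t) + b x(t - tau), t > 0.
   The restriction of x to [-tau, 0] is the prescribed (continuous) history; the
   values of x on ]-oo, -tau[ play no role. *)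
Definition solution {R : realType} (a b c alpha tau : R) (x : R -> R) : Prop :=
  [/\ {within `[- tau, +oo[, continuous x},
      caputo_differentiable alpha x,
      caputo_differentiable (2 * alpha) x
    & forall t : R, 0 < t ->
        caputo alpha x t + c * caputo (2 * alpha) x t
        = a * x t + b * x (t - tau)].

Definition stable {R : realType} (a b c alpha tau : R) : Prop :=
  forall x : R -> R, solution a b c alpha tau x -> bounded_near x (pinfty_nbhs R).

Definition unstable {R : realType} (a b c alpha tau : R) : Prop :=
  ~ stable a b c alpha tau.

Local Open Scope complex_scope.

Definition Cexp {R : realType} (z : R[i]) : R[i] :=
  (expR (complex.Re z))%:C * (cos (complex.Im z) +i* sin (complex.Im z)).

(* Principal argument, in ]-pi, pi], for z != 0. *)
Definition Carg {R : realType} (z : R[i]) : R :=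
  let theta := acos (complex.Re z / ComplexField.Normc.normc z) in
  if 0 <= complex.Im z then theta else - theta.

Definition Clog {R : realType} (z : R[i]) : R[i] := ln (ComplexField.Normc.normc z) +i* Carg z.

(* Principal branch of z ^ p, with 0 ^ 0 = 1 and 0 ^ p = 0 for p != 0. *)
Definition Cpow {R : realType} (z : R[i]) (p : R) : R[i] :=
  if z == 0 then ((p == 0)%:R : R)%:C else Cexp (p%:C * Clog z).

Definition characteristic_root {R : realType}
    (a b c alpha tau : R) (lambda : R[i]) : Prop :=
  Cpow lambda alpha + c%:C * Cpow lambda (2 * alpha)
  = a%:C + b%:C * Cexp (- (lambda * tau%:C)).

Definition critical_delay {R : realType} (a b c alpha tau : R) : Prop :=
  0 <= tau /\
  exists v : R, 0 < v /\ characteristic_root a b c alpha tau (0 +i* v).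

(* Main.v *)
(** The stability claims reduce to a maximum principle: for every delay [tau >= 0],
    all solutions are bounded by their history, so that [stable] holds for all
    delays.  If [|x|] attains over [[-tau, t1]] a value [P > 0] at [t0 > 0] that
    exceeds the history, then, up to the sign of [x t0], both Caputo
    derivatives are nonnegative at [t0], whereas the right-hand side is at most
    [a * P + |b| * P < 0].

    At a maximum [t0] of [f] over [[0, t0]] the Caputo derivative of order
    [0 < nu < 1] is a positive multiple of the integral of
    [(t0 - s)^(- nu) * f'(s)].  Writing the kernel as the integral over [u] of
    the indicators of its superlevel sets, which are tails []s_u, t0[], and
    applying Fubini, the integral becomes a superposition of the nonnegative
    increments [f(t0) - f(s_u)].

    There is no critical delay since, at [i v], the real part of the left-hand
    side of the characteristic equation is nonnegative, while that of the
    right-hand side is at most [a + |b| < 0]. *)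

Require Import Defs.
From HB Require Import structures.
From mathcomp Require Import all_boot all_order all_algebra.
From mathcomp Require Import all_classical all_reals all_analysis.
From mathcomp Require Import measurable_realfun complex lra.

Import Order.TTheory GRing.Theory Num.Theory.
Import numFieldNormedType.Exports.

Local Open Scope ring_scope.
Local Open Scope classical_set_scope.

Local Notation mu := lebesgue_measure.

Set Implicit Arguments.
Unset Strict Implicit.

(** * Nonnegativity of integrals against a power kernel *)

Lemma Rintegral_ge0_of_tails (R : realType) (T : R) (g : R -> R) : 0 < T ->
  mu.-integrable `]0, T[ (EFin \o g) ->
  (forall s : R, 0 < s < T -> 0 <= \int[mu]_(r in `]s, T[) g r) ->
  0 <= \int[mu]_(r in `]0, T[) g r.
Proof.
move=> T0 ig tail; pose f := g \_ `]0, T[.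
have fT : mu.-integrable `[0, T] (EFin \o f).
  rewrite /f -restrict_EFin; apply/integrable_restrict => //=.
  by rewrite setIidr//; exact: subset_itv_oo_cc.
have -> : \int[mu]_(r in `]0, T[) g r =
          \int[mu]_(r in `[0, T]) f r.
  by rewrite /f -Rintegral_mkcondr setIidr//; exact: subset_itv_oo_cc.
(* The integral from 0 to [z] vanishes as [z] tends to 0, while for each [s > 0] the whole integral
   exceeds the one up to [s] by a nonnegative tail. *)
have cv := @parameterized_integral_cvg_left R 0 T f T0 fT.
move/cvg_at_right_filter : cv => cv.
apply: le_trans (_ : lim (parameterized_integral mu 0 z f @[z --> 0^'+]) <= _).
  by rewrite (cvg_lim (@Rhausdorff R) cv).
apply: limr_le.
  by apply/cvg_ex; exists 0.
near=> s.
have s0 : 0 < s by near: s; exact: nbhs_right_gt.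
have sT : s < T by near: s; exact: nbhs_right_lt.
rewrite -subr_ge0 /parameterized_integral Rintegral_itvB ?bnd_simp//;
  [|exact: ltW..].
rewrite /f -Rintegral_mkcondr.
have -> : `]s, T] `&` `]0, T[ = `]s, T[ :> set R.
  apply/seteqP; split => r /=; rewrite !in_itv/=.
    by move=> [/andP[-> _] /andP[_ ->]].
  by move=> /andP[sr rT]; rewrite sr rT (ltW rT) (lt_trans s0 sr).
by apply: tail; rewrite s0.
Unshelve. all: by end_near. Qed.

(** With [x = T - s], the superlevel set of the kernel at level [u] becomes the tail
    [s > T - u^(-1/q)]. *)
Lemma ltr_powRN (R : realType) (q x u : R) : 0 < q -> 0 < x -> 0 < u ->
  (u < x `^ (- q)) = (x < u^-1 `^ q^-1).
Proof.
move=> q0 x0 u0; rewrite powRN.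
have -> : (u < (x `^ q)^-1) = (x `^ q < u^-1).
  by rewrite invf_pgt ?posrE ?powR_gt0.
have ui : 0 <= u^-1 by rewrite invr_ge0 ltW.
apply/idP/idP => [lt|lt].
  have -> : x = (x `^ q) `^ q^-1.
    by rewrite -powRrM mulfV ?powRr1 ?gt_eqF// ltW.
  by apply: gt0_ltr_powR; rewrite ?invr_gt0// nnegrE powR_ge0.
have -> : u^-1 = (u^-1 `^ q^-1) `^ q.
  by rewrite -powRrM mulVf ?powRr1 ?gt_eqF.
by apply: gt0_ltr_powR => //; rewrite nnegrE ?powR_ge0 ?ltW.
Qed.

Lemma measurable_powR_subr (R : realType) (T p : R) :
  measurable_fun [set: R] (fun s : R => (T - s) `^ p).
Proof.
apply: (measurableT_comp (measurable_powR p)).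
by apply: measurable_funB => //; exact: measurable_id.
Qed.

(** On []0, T[] the kernel is at least [T^(-q)], so [|g|] is dominated by [T^q] times the integrable
    product. *)
Lemma integrable_powR_factor (R : realType) (T q : R) (g : R -> R) :
  0 < T -> 0 < q ->
  mu.-integrable `]0, T[ (fun s => ((T - s) `^ (- q) * g s)%:E) ->
  mu.-integrable `]0, T[ (EFin \o g).
Proof.
move=> T0 q0 ih.
pose k s := (T - s) `^ (- q).
have kE s : s < T -> k s * (T - s) `^ q = 1.
  by move=> sT; rewrite /k powRN mulVf// gt_eqF// powR_gt0// subr_gt0.
have mh : measurable_fun `]0, T[ (fun s => k s * g s).
  by apply/measurable_EFinP; exact: (measurable_int _ ih).
have mg : measurable_fun `]0, T[ g.
  apply: (eq_measurable_fun (fun s : R => (T - s) `^ q * (k s * g s))).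
    move=> s; rewrite inE/= in_itv/= => /andP[_ sT].
    by rewrite mulrA (mulrC _ (k s)) kE// mul1r.
  apply: measurable_funM => //.
  exact: measurable_funS (@measurable_powR_subr R T q).
apply: (@le_integrable _ _ _ mu _ _ _
    (fun s : R => (T `^ q)%:E * (k s * g s)%:E)%E) => //.
- exact/measurable_EFinP.
- move=> s /=; rewrite in_itv/= => /andP[s0 sT].
  rewrite lee_fin !normrM mulrA ger0_norm ?powR_ge0// ger0_norm ?powR_ge0//.
  rewrite ler_peMl// -(kE s)// mulrC ler_wpM2r ?powR_ge0//.
  by apply: ge0_ler_powR; rewrite ?nnegrE; lra.
- exact: integrableZl.
Qed.

Lemma Rintegral_powR_ge0_of_tails (R : realType) (T q : R) (g : R -> R) :
  0 < T -> 0 < q ->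
  mu.-integrable `]0, T[ (fun s => ((T - s) `^ (- q) * g s)%:E) ->
  (forall s : R, 0 < s < T -> 0 <= \int[mu]_(r in `]s, T[) g r) ->
  0 <= \int[mu]_(s in `]0, T[) ((T - s) `^ (- q) * g s).
Proof.
move=> T0 q0 ih tail.
pose k s := (T - s) `^ (- q).
have ig := integrable_powR_factor T0 q0 ih.
have mg : measurable_fun `]0, T[ g.
  by apply/measurable_EFinP; exact: (measurable_int _ ig).
(* The endpoint [s = 0] is added for the levels [u] below which the kernel never falls. *)
have tail0 s : 0 <= s < T -> (0 <= \int[mu]_(r in `]s, T[) (g r)%:E)%E.
  move=> /andP[s0 sT].
  have : 0 <= \int[mu]_(r in `]s, T[) g r.
    move: s0; rewrite le_eqVlt => /predU1P[<-|s0].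
      exact: Rintegral_ge0_of_tails.
    by apply: tail; rewrite s0.
  rewrite -lee_fin /Rintegral fineK//; apply: integrable_fin_num => //.
  apply: (@integrableS _ _ _ mu `]0, T[) => //.
  by apply: subset_itvr; rewrite bnd_simp.
pose G := g \_ `]0, T[.
have mG : measurable_fun [set: R] G.
  by have := (@measurable_restrictT _ _ _ _ `]0, T[ g _).1; apply.
(* The region under the graph of [k]: its slice at [s] is []0, k s[], of measure [k s]. *)
pose A := [set z : R * R | (0 < z.2) && (z.2 < k z.1)].
have mA : measurable A.
  suff : measurable_fun [set: R * R] (fun z => (0 < z.2) && (z.2 < k z.1)).
    by move=> /(_ measurableT [set true]); rewrite setTI; apply.
  apply: measurable_and; apply: measurable_fun_ltr => //.
  by apply: measurableT_comp => //; exact: measurable_powR_subr.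
have AE s u : \1_A (s, u) = \1_(`]0, k s[) u :> R.
  rewrite !indicE.
  suff -> : ((s, u) \in A) = (u \in `]0, k s[%classic) by [].
  by apply/idP/idP => /set_mem; rewrite /A/= ?in_itv/= => us;
    apply/mem_set; rewrite /= ?in_itv.
have slice (c s : R) : (\int[mu]_u (c * \1_A (s, u))%:E = (c * k s)%:E)%E.
  under eq_integral do rewrite AE EFinM.
  rewrite integralZl//; last exact: integrable_indic_itv.
  rewrite integral_indic// setIT.
  transitivity (c%:E * mu `]0%R, k s[%classic)%E => //.
  rewrite lebesgue_measure_itv/= lte_fin.
  have := powR_ge0 (T - s) (- q); rewrite -/(k s) le_eqVlt => /predU1P[<-|->].
    by rewrite ltxx mulr0 mule0.
  by rewrite -EFinB subr0.
pose F (z : R * R) := (G z.1 * \1_A z)%:E.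
have mF : measurable_fun [set: R * R] F.
  apply/measurable_EFinP/measurable_funM => //.
  by apply: measurableT_comp.
have absF s : (\int[mu]_u `|F (s, u)| = `|G s * k s|%:E)%E.
  under eq_integral do rewrite /F/= normrM (ger0_norm (x := \1_A _))//.
  by rewrite slice normrM (ger0_norm (powR_ge0 _ _)).
(* By Tonelli the integral of [|F|] is that of [|k * g|] over []0, T[], finite by [ih]. *)
have iF : (mu \x mu)%E.-integrable [set: R * R] F.
  apply/integrable12ltyP => //.
  under eq_integral do rewrite absF.
  have := integrableP _ _ _ ih => -[_]; apply: le_lt_trans.
  rewrite [leRHS]integral_mkcond; rewrite le_eqVlt; apply/orP; left; apply/eqP.
  apply: eq_integral => s _; rewrite /G /= !patchE; case: ifPn => //= _.
    by rewrite mulrC.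
  by rewrite mul0r normr0.
rewrite /Rintegral fine_ge0//.
rewrite (_ : integral _ _ _ = \int[mu]_s \int[mu]_u F (s, u))%E; last first.
  transitivity (\int[mu]_s (G s * k s)%:E)%E.
    rewrite integral_mkcond; apply: eq_integral => s _; rewrite /G/= !patchE.
    by case: ifPn => //= _; rewrite ?mul0r// mulrC.
  by apply: eq_integral => s _; rewrite -slice.
rewrite Fubini//; apply: integral_ge0 => u _.
have [u0|u0] := leP u 0.
  rewrite integral0_eq// => s _; rewrite /F indicE/= memNset ?mulr0//=.
  by rewrite /A/= ltNge u0.
(* For small [u] the kernel exceeds [u] on all of []0, T[]; the maximum with 0 covers this case. *)
pose s0 := Num.max 0 (T - u^-1 `^ q^-1).
rewrite (_ : integral _ _ _ = \int[mu]_(r in `]s0, T[) (g r)%:E)%E; last first.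
  rewrite [RHS]integral_mkcond; apply: eq_integral => s _.
  rewrite /F /G indicE.
  have -> : ((s, u) \in A) = (u < k s).
    apply/idP/idP => [/set_mem/andP[]//|uk].
    by apply/mem_set; rewrite /A/= u0.
  rewrite !patchE !mem_setE !in_itv/= /s0 gt_max.
  case: (ltP 0 s) => /= [s1|_]; last by rewrite mul0r.
  case: (ltP s T) => /= [sT|_]; last by rewrite andbF mul0r.
  rewrite /k ltr_powRN ?subr_gt0// andbT ltrBlDr ltrBlDl.
  by case: ifPn => _; rewrite ?mulr1 ?mulr0.
apply: tail0; rewrite /s0 le_max lexx/= gt_max T0/= ltrBlDr ltrDl.
by rewrite powR_gt0 ?invr_gt0.
Qed.

(** * The characteristic equation on the imaginary axis *)

Lemma Re_Cpow_imaginary_ge0 (R : realType) (v p : R) : 0 < v -> 0 <= p <= 1 ->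
  0 <= complex.Re (Cpow (0 +i* v)%C p).
Proof.
move=> v0 /andP[p0 p1]; rewrite /Cpow eq_complex/= (gt_eqF v0) andbF /=.
rewrite !mul0r !subr0 mulr_ge0 ?expR_ge0//.
(* The argument of [i v] is [pi / 2], so the sign is that of the cosine of [p * pi / 2], an angle in
   [[0, pi / 2]]. *)
rewrite /Carg/= (ltW v0) mul0r acos0 addr0.
have := pi_ge0 R => pi0; apply: cos_ge0_pihalf; nra.
Qed.

Lemma no_critical_delay (R : realType) (a b c alpha tau : R) :
  0 < c -> 0 < alpha -> alpha <= 1 / 2 -> a < - `|b| ->
  ~ critical_delay a b c alpha tau.
Proof.
move=> c0 al0 al1 ab [_ [v [v0]]] /(congr1 (@complex.Re R)).
rewrite /= !(mul0r, mulr0, subr0, add0r, oppr0, expR0, mul1r).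
have h1 : 0 <= alpha <= 1 by lra.
have h2 : 0 <= 2 * alpha <= 1 by lra.
have := Re_Cpow_imaginary_ge0 v0 h1; have := Re_Cpow_imaginary_ge0 v0 h2.
case: (Cpow _ (2 * alpha)) => r2 i2; case: (Cpow _ alpha) => r1 i1 /=.
rewrite mul0r subr0 => r20 r10 e.
have : b * cos (- (v * tau)) <= `|b|.
  by rewrite (le_trans (ler_norm _))// normrM ler_piMr// cos_max.
by have := mulr_ge0 (ltW c0) r20; lra.
Qed.

(** * Sign of the Caputo derivative at an extremum *)

Lemma caputo_order1 (R : realType) (nu : R) : 0 < nu <= 1 -> caputo_order nu = 1%N.
Proof.
move=> /andP[m0 m1]; rewrite /caputo_order.
by rewrite (@ceil_def _ _ 1)// subrr m0.
Qed.

(** Values are compared only to the left of [t], so the derivative is computed from left difference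
    quotients, whose numerator and denominator are both nonpositive. *)
Lemma derive1_left_max_ge0 (R : realType) (f : R -> R) (t : R) : 0 < t ->
  derivable f t 1 -> (forall s : R, 0 < s < t -> f s <= f t) -> 0 <= derive1 f t.
Proof.
move=> t0 df fmax; rewrite derive1E ['D_1 f t]cvg_at_leftE//.
apply: limr_ge.
  rewrite -(cvg_at_leftE (fun h => h^-1 *: ((f \o shift t) _ - f t))) //.
  apply: cvg_trans df; apply: cvg_app.
  move=> A [e egt0 Ae]; exists e => // x xe xgt0; apply: Ae => //.
  exact/ltr0_neq0.
near=> h.
have h0 : h < 0 by near: h; exact: nbhs_left_lt.
have ht : - t < h by near: h; apply: nbhs_left_gt; rewrite oppr_lt0.
apply: mulr_le0; first by rewrite invr_le0 ltW.
rewrite subr_le0 [_%:A]mulr1; apply: fmax => /=; lra.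
Unshelve. all: by end_near. Qed.

(* Taking [e = 1] covers maxima, [e = -1] minima. *)
Lemma caputo_extremum_ge0 (R : realType) (nu e t : R) (f : R -> R) :
  0 < nu <= 1 -> caputo_differentiable nu f -> 0 < t ->
  (forall s : R, 0 < s < t -> e * f s <= e * f t) -> 0 <= e * caputo nu f t.
Proof.
move=> nu01 + t0 fmax; have [nu0 _] := andP nu01.
rewrite /caputo_differentiable /caputo /caputo_integrand (caputo_order1 nu01) /=.
(* The case [nu = 1] is the ordinary derivative; it arises for the order [2 * alpha] when
   [alpha = 1 / 2]. *)
case: eqP => [_ df|_ [_ _ ih fE]].
  have d : derivable f t 1 by exact: df 0%N t isT t0.
  rewrite -[e * _]/(e *: derive1 f t) derive1E -deriveZ//= -derive1E.
  apply: derive1_left_max_ge0 => //; exact: derivableZ.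
have nu_exp : 1%:R - nu - 1 = - nu by rewrite addrAC subrr add0r.
have {}ih : mu.-integrable `]0, t[
    (fun s : R => ((t - s) `^ (- nu) * derive1 f s)%:E).
  by have := ih t t0; rewrite nu_exp.
rewrite nu_exp mulrCA mulr_ge0// ?invr_ge0.
  by apply: Rintegral_ge0 => u _; rewrite mulr_ge0 ?powR_ge0 ?expR_ge0.
rewrite -RintegralZl//.
rewrite (_ : Rintegral _ _ _ = \int[mu]_(s in `]0, t[)
    ((t - s) `^ (- nu) * (e * derive1 f s))); last first.
  by apply: eq_Rintegral => s _; rewrite mulrCA.
apply: Rintegral_powR_ge0_of_tails => //.
  rewrite (_ : (fun s => _) =
      fun s : R => (e%:E * ((t - s) `^ (- nu) * derive1 f s)%:E)%E).
    exact: integrableZl.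
  by apply/funext => s; rewrite -EFinM mulrCA.
(* Absolute continuity, [fE], turns the tail into the increment [e * (f t - f s)]. *)
move=> s /andP[s0 st]; rewrite RintegralZl//.
  by rewrite -fE// mulrBr subr_ge0 fmax// s0.
apply: (@integrableS _ _ _ mu `]0, t[) => //.
  by apply: subset_itvr; rewrite bnd_simp ltW.
exact: integrable_powR_factor ih.
Qed.

(** * Boundedness of solutions *)

Lemma all_delays_stable (R : realType) (a b c alpha tau : R) :
  0 < c -> 0 < alpha -> alpha <= 1 / 2 -> a < - `|b| -> 0 <= tau ->
  stable a b c alpha tau.
Proof.
move=> c0 al0 al1 ab tau0 x [cx dx1 dx2 eqx].
have cabs u : {within `[- tau, u], continuous (fun t => `|x t|)}.
  have : {within `[- tau, u], continuous x}.
    by apply: continuous_subspaceW cx; apply: subset_itvl.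
  by move=> cu t; apply: cvg_norm; exact: cu.
have tau0' : - tau <= 0 by rewrite oppr_le0.
have [c1 _ hist] := EVT_max tau0' (cabs 0).
apply/ex_bound; exists `|x c1|; near=> t1.
have t10 : 0 <= t1 by near: t1; exact: nbhs_pinfty_ge.
rewrite /= leNgt; apply/negP => big.
have [t0 + tmax] := EVT_max (le_trans tau0' t10) (cabs t1).
rewrite in_itv/= => /andP[t0l t0r].
have big0 : `|x c1| < `|x t0|.
  by apply: lt_le_trans big (tmax _ _); rewrite in_itv/= lexx (le_trans tau0').
have t00 : 0 < t0.
  rewrite ltNge; apply/negP => t0n; move: big0; apply/negP; rewrite -leNgt.
  by apply: hist; rewrite in_itv/= t0l.
(* Multiplying by the sign of [x t0] turns the maximum of [|x|] into a maximum of a signed multiple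
   of [x]. *)
have sgx s : - tau <= s <= t1 -> Num.sg (x t0) * x s <= `|x t0|.
  move=> st; apply: le_trans (ler_norm _) _; rewrite normrM normr_sg.
  by apply: le_trans (ler_piMl _ _) (tmax s _); rewrite ?in_itv//= lern1 leq_b1.
have P0 : 0 < `|x t0| by exact: le_lt_trans big0.
have max0 s : 0 < s < t0 -> Num.sg (x t0) * x s <= Num.sg (x t0) * x t0.
  move=> st; rewrite -normrEsg; apply: sgx; lra.
have h1 : 0 < alpha <= 1 by lra.
have h2 : 0 < 2 * alpha <= 1 by lra.
have := caputo_extremum_ge0 h1 dx1 t00 max0.
have := caputo_extremum_ge0 h2 dx2 t00 max0.
have := congr1 (fun y => Num.sg (x t0) * y) (eqx t0 t00).
(* The point [t0 - tau] lies in [[-tau, t1]] whatever the delay, so the maximum at [t0] bounds the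
   delayed value too. *)
have : `|Num.sg (x t0) * (b * x (t0 - tau))| <= `|b| * `|x t0|.
  rewrite !normrM normr_sg; apply: le_trans (ler_piMl _ _) _ => //.
    by rewrite lern1 leq_b1.
  by rewrite ler_wpM2l// tmax// in_itv/=; lra.
move=> /(le_trans (ler_norm _)).
rewrite /= !mulrDr [_ * (a * _)]mulrCA -normrEsg [_ * (c * _)]mulrCA.
move=> bx e C2 C1; have := mulr_ge0 (ltW c0) C2.
have : a * `|x t0| < - `|b| * `|x t0| by rewrite ltr_pM2r.
lra.
Unshelve. all: by end_near. Qed.

Local Close Scope classical_set_scope.
Unset Implicit Arguments.

Theorem mainTheorem1 (R : realType) (a b c alpha : R) :
  0 < c -> 0 < alpha -> alpha <= 1 / 2 -> a < - `|b| ->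
  (~ exists tau : R, critical_delay a b c alpha tau) /\
  (stable a b c alpha 0 ->
     forall tau : R, 0 <= tau -> stable a b c alpha tau) /\
  (unstable a b c alpha 0 ->
     forall tau : R, 0 <= tau -> unstable a b c alpha tau).
Proof.
move=> c0 al0 al1 ab; have st tau := all_delays_stable c0 al0 al1 ab (tau := tau).
split; first by move=> [tau]; exact: no_critical_delay.
by split=> [_ tau /st//|unst0]; case: unst0; exact: st.
Qed.
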